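(* Let $\mathbb U$ and $\mathbb V$ be Banach spaces and let $B:\mathbb U\to\mathbb V^*$ be a linear operator with $\gamma_B\|w\|_{\mathbb U}\le\|Bw\|_{\mathbb V^*}\le M_B\|w\|_{\mathbb U}$ for all $w\in\mathbb U$, where $M_B>0$ and $\gamma_B>0$. Assume that $\mathbb V$ and $\mathbb V^*$ are reflexive and strictly convex. Let $\mathbb U_n\subset\mathbb U$ and $\mathbb V_m\subset\mathbb V$ be finite-dimensional subspaces such that the Fortin condition holds: there exist an operator $\Pi:\mathbb V\to\mathbb V_m$ and constants $C_\Pi>0$, $D_\Pi>0$ such that $\|\Pi v\|_{\mathbb V}\le C_\Pi\|v\|_{\mathbb V}$ and $\|v-\Pi v\|_{\mathbb V}\le D_\Pi\|v\|_{\mathbb V}$ for all $v\in\mathbb V$, and $\langle Bw_n,v-\Pi v\rangle_{\mathbb V^*,\mathbb V}=0$ for all $w_n\in\mathbb U_n$ and $v\in\mathbb V$. Given $f=Bu\in\mathbb V^*$ with $u\in\mathbb U$, let $(r_m,u_n)\in\mathbb V_m\times\mathbb U_n$ be the unique solution of $$\langle J_{\mathbb V}(r_m),v_m\rangle_{\mathbb V^*,\mathbb V}+\langle Bu_n,v_m\rangle_{\mathbb V^*,\mathbb V}=\langle f,v_m\rangle_{\mathbb V^*,\mathbb V}\quad\forall v_m\in\mathbb V_m,\qquad\langle Bw_n,r_m\rangle_{\mathbb V^*,\mathbb V}=0\quad\forall w_n\in\mathbb U_n .$$ Then $u_n$ satisfies the a posteriori error estimate $$\|u-u_n\|_{\mathbb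 U}\le\frac1{\gamma_B}\,\mathrm{osc}(f)+\frac{C_\Pi}{\gamma_B}\|r_m\|_{\mathbb V},$$ where the data-oscillation term satisfies $$\mathrm{osc}(f):=\sup_{v\in\mathbb V\setminus\{0\}}\frac{\langle f,v-\Pi v\rangle_{\mathbb V^*,\mathbb V}}{\|v\|_{\mathbb V}}\le M_BD_\Pi\inf_{w_n\in\mathbb U_n}\|u-w_n\|_{\mathbb U},$$ and $$\|r_m\|_{\mathbb V}\le M_B\inf_{w_n\in\mathbb U_n}\|u-w_n\|_{\mathbb U}.$$
   Context: All spaces are real. For a normed space $\mathbb Y$, the duality mapping is $\mathcal J_{\mathbb Y}(y)=\{y^*\in\mathbb Y^*:\langle y^*,y\rangle=\|y\|_{\mathbb Y}^2=\|y^*\|_{\mathbb Y^*}^2\}$. A normed space is strictly convex if $\|\theta y_1+(1-\theta)y_2\|<1$ whenever $y_1\ne y_2$, $\|y_1\|=\|y_2\|=1$, $\theta\in(0,1)$. If $\mathbb Y$ and $\mathbb Y^*$ are strictly convex and reflexive Banach spaces, then $\mathcal J_{\mathbb Y}(y)=\{J_{\mathbb Y}(y)\}$ is single-valued and $J_{\mathbb Y}:\mathbb Y\to\mathbb Y^*$ is a bijection (known fact). Under the stated hypotheses the discrete mixed problem has a unique solution. *)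

(* Defs.v *)
From HB Require Import structures.
From mathcomp Require Import all_boot all_order all_algebra.
From mathcomp Require Import boolp classical_sets functions reals.
From mathcomp Require Import topology tvs normedtype.

Set Implicit Arguments.
Unset Strict Implicit.
Unset Printing Implicit Defensive.

Import Order.TTheory GRing.Theory Num.Theory.
Import numFieldNormedType.Exports.

Local Open Scope classical_set_scope.
Local Open Scope ring_scope.

(* The topological dual: [f : dual V] is a continuous linear functional on [V],
   and the duality pairing of [f] with [v] is the application [f v]. *)
Section dual.
Context {R : realType} (V : normedModType R).

Definition dual_pred : {pred V -> R^o} :=
  mem [set f : V -> R^o | linear f /\ continuous f].

Record dual := Dual { dual_fun :> V -> R^o; dualP : dual_fun \in dual_pred }.

HB.instance Definition _ := [isSub for dual_fun].
HB.instance Definition _ := gen_eqMixin dual.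
HB.instance Definition _ := gen_choiceMixin dual.

Lemma dual_linear (f : dual) : linear f.
Proof. by case: f => f /=; rewrite inE => -[]. Qed.

HB.instance Definition _ (f : dual) :=
  GRing.isLinear.Build R V R^o *:%R f (dual_linear f).

Lemma dual_continuous (f : dual) : continuous f.
Proof. by case: f => f /=; rewrite inE => -[]. Qed.

Lemma dual_submod_closed : submod_closed dual_pred.
Proof.
split=> [|a f g]; rewrite !inE.
  by split=> [a x y|]; [rewrite /= scaler0 addr0|exact: cst_continuous].
move=> [lf cf] [lg cg]; split=> [b x y|x].
  rewrite !fctE lf lg !scalerDr !scalerA mulrC !addrA; congr (_ + _).
  by rewrite -!addrA; congr (_ + _); rewrite addrC.
by apply: cvgD; [apply: cvgZl_tmp; exact: cf|exact: cg].
Qed.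

HB.instance Definition _ := GRing.isSubmodClosed.Build R (V -> R^o) dual_pred
  dual_submod_closed.
HB.instance Definition _ := [SubChoice_isSubLmodule of dual by <:].

Definition dual_norm (f : dual) : R :=
  sup [set `|f v| | v in [set v | `|v| <= 1]].

Lemma dual_norm_has_sup (f : dual) :
  has_sup [set `|f v| | v in [set v | `|v| <= 1]].
Proof.
split; first by exists `|f 0|; exists 0 => //=; rewrite normr0.
have := continuous_linear_bounded 0 (@dual_continuous f 0).
move=> /linear_boundedP /pinfty_ex_gt0[r r0 fr].
exists r => _ [v /= v1 <-].
by rewrite (le_trans (fr v))// ler_piMr// ltW.
Qed.

Lemma dual_norm_ub (f : dual) (v : V) : `|v| <= 1 -> `|f v| <= dual_norm f.
Proof.
by move=> v1; apply: (ub_le_sup (dual_norm_has_sup f).2); exists v.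
Qed.

Lemma dual_norm_le (f : dual) (M : R) :
  (forall v, `|v| <= 1 -> `|f v| <= M) -> dual_norm f <= M.
Proof.
by move=> fM; apply: ge_sup (dual_norm_has_sup f).1 _ => _ [v v1 <-]; exact: fM.
Qed.

Lemma ler_dual_pairing (f : dual) (v : V) : `|f v| <= dual_norm f * `|v|.
Proof.
have [->|v0] := eqVneq v 0; first by rewrite linear0 !normr0 mulr0.
have v_gt0 : 0 < `|v| by rewrite normr_gt0.
rewrite -ler_pdivrMr//.
have -> : `|f v| / `|v| = `|f (`|v|^-1 *: v)|.
  by rewrite linearZ /= normrZ normfV normr_id mulrC.
by apply: dual_norm_ub; rewrite normrZ normfV normr_id mulVf// gt_eqF.
Qed.

Lemma dual_ext (f g : dual) : f =1 g -> f = g.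
Proof. by move=> fg; apply/val_inj/funext. Qed.

Lemma dual_normD (f g : dual) : dual_norm (f + g) <= dual_norm f + dual_norm g.
Proof.
apply: dual_norm_le => v v1.
by rewrite (le_trans (ler_normD _ _))// lerD// dual_norm_ub.
Qed.

Lemma dual_normZ (a : R) (f : dual) :
  dual_norm (a *: f) = `|a| * dual_norm f.
Proof.
have le b g : dual_norm (b *: g) <= `|b| * dual_norm g.
  apply: dual_norm_le => v v1.
  by rewrite [X in `|X|]/(b * g v) normrM ler_wpM2l// dual_norm_ub.
apply/eqP; rewrite eq_le le /=.
have [->|a0] := eqVneq a 0.
  by rewrite normr0 mul0r (le_trans _ (dual_norm_ub (v := 0) _ _))// normr0.
rewrite -ler_pdivlMl ?normr_gt0// -normfV.
by rewrite -{1}[f](scalerK a0) le.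
Qed.

Lemma dual_norm0_eq0 (f : dual) : dual_norm f = 0 -> f = 0.
Proof.
move=> f0; apply: dual_ext => v; apply/eqP; rewrite -normr_le0.
by rewrite (le_trans (ler_dual_pairing f v))// f0 mul0r.
Qed.

HB.instance Definition _ := Lmodule_isNormed.Build R dual
  dual_normD dual_normZ dual_norm0_eq0.

End dual.

Arguments dual_pred {R} V.

Section normed_spaces.
Context {R : realType} (Y : normedModType R).

Lemma bidual_embed_subproof (y : Y) :
  (fun f : dual Y => f y : R^o) \in dual_pred (dual Y).
Proof.
have lin : linear (fun f : dual Y => f y : R^o) by [].
pose lf := GRing.isLinear.Build R (dual Y) R^o *:%R _ lin.
pose ev : {linear dual Y -> R^o} := HB.pack (fun f : dual Y => f y : R^o) lf.
rewrite inE; split => //.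
apply: (bounded_linear_continuous (f := ev)); apply/linear_boundedP.
near=> r; have yr : `|y| <= r by near: r; apply: nbhs_pinfty_ge; exact: num_real.
by move=> f; rewrite (le_trans (ler_dual_pairing f y))// mulrC; exact: (ler_wpM2r (normr_ge0 f) yr).
Unshelve. all: by end_near. Qed.

Definition bidual_embed (y : Y) : dual (dual Y) :=
  Dual (bidual_embed_subproof y).

Definition reflexive_space := range bidual_embed = [set: dual (dual Y)].

Definition strictly_convex_space := forall (y1 y2 : Y) (t : R),
  y1 <> y2 -> `|y1| = 1 -> `|y2| = 1 -> 0 < t < 1 ->
  `|t *: y1 + (1 - t) *: y2| < 1.

Definition duality_map (y : Y) : set (dual Y) :=
  [set g : dual Y | g y = `|y| ^+ 2 /\ `|y| ^+ 2 = `|g| ^+ 2].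

(* Meaningful when [duality_map y] is a singleton, which holds for every [y]
   as soon as [Y] is a reflexive Banach space and [Y] and [dual Y] are strictly
   convex; the default value [0] is then never used. *)
Definition duality_fun (y : Y) : dual Y := xget 0 (duality_map y).

Definition findim_subspace (S : set Y) :=
  submod_closed [in S] /\
  exists (n : nat) (e : 'I_n -> Y), forall x, S x ->
    exists c : 'I_n -> R, x = \sum_(i < n) c i *: e i.

(* [sup] is the real supremum; the set is bounded above whenever
   [`|v - Pi v| <= D * `|v|] for all [v], and it is empty only for the zero
   space, where [sup set0 = 0]. *)
Definition osc (Pi : Y -> Y) (f : dual Y) : R :=
  sup [set f (v - Pi v) / `|v| | v in [set v | v != 0]].

End normed_spaces.

Definition best_error {R : realType} {X : normedModType R} (x : X) (S : set X)
  : R := inf [set `|x - w| | w in S].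

(* Main.v *)
(** The residual equation and the Fortin property give, for every [v],
    [B (u - u_n) v = f (v - Pi v) + J r_m (Pi v)], which bounds
    [|B (u - u_n)|] by [osc f + C_Pi |r_m|]; the two remaining bounds come
    from [B w_n (v - Pi v) = 0] and from
    [|r_m|^2 = J r_m r_m = B (u - u_n) r_m = B (u - w_n) r_m].
    The latter needs the duality mapping to be nonempty at [r_m], i.e. a
    norming functional, obtained as a minimal sublinear functional below the
    norm: if [p] is sublinear, so is
    [x |-> inf_(t >= 0) (p (x + t y) - t p y)], which lies below [p] and takes
    a value [<= - p y] at [- y].  Hence a minimal sublinear functional is odd,
    thus linear; and applying Zorn's lemma below the functional so built from
    the norm and [y] makes the minimal one norming at [y]. *)
Require Import Defs.
From HB Require Import structures.
From mathcomp Require Import all_boot all_order all_algebra.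
From mathcomp Require Import boolp classical_sets functions reals.
From mathcomp Require Import topology tvs normedtype.
From mathcomp Require Import lra.

Import Order.TTheory GRing.Theory Num.Theory.
Import numFieldNormedType.Exports.

Local Open Scope classical_set_scope.
Local Open Scope ring_scope.

(** * Sublinear functionals and Hahn-Banach at a point *)

Section sublinear_functionals.
Context {R : realType} {V : lmodType R}.
Implicit Types (p q : V -> R) (F : set (V -> R)).

Definition sublinear p :=
  (forall x y, p (x + y) <= p x + p y) /\
  (forall (a : R) x, 0 < a -> p (a *: x) <= a * p x).

Lemma sublinear0 p : sublinear p -> p 0 = 0.
Proof.
move=> [pD pZ]; apply/eqP; rewrite eq_le; apply/andP; split.
  by have := pZ 2^-1 0 ltac:(lra); rewrite scaler0; lra.
by have := pD 0 0; rewrite addr0; lra.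
Qed.

Lemma sublinear_ge p x : sublinear p -> - p (- x) <= p x.
Proof.
by move=> sp; have := sp.1 x (- x); rewrite subrr sublinear0//; lra.
Qed.

(** Under oddness, each sublinearity inequality taken at [- x] and [- y] becomes the reverse
    inequality at [x] and [y]. *)
Lemma sublinear_odd_linear p : sublinear p -> (forall x, p (- x) <= - p x) ->
  linear (p : V -> R^o).
Proof.
move=> sp pN.
have podd x : p (- x) = - p x.
  by apply/eqP; rewrite eq_le pN /=; have := sublinear_ge p x sp; lra.
have pD x y : p (x + y) = p x + p y.
  apply/eqP; rewrite eq_le sp.1 /=.
  by have := sp.1 (- x) (- y); rewrite -opprD !podd; lra.
have pZ (a : R) x : 0 < a -> p (a *: x) = a * p x.
  move=> a0; apply/eqP; rewrite eq_le sp.2 //=.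
  by have := sp.2 a (- x) a0; rewrite scalerN !podd; lra.
suff pZ' a x : p (a *: x) = a * p x by move=> a x y; rewrite pD pZ'.
have [a0|a0|->] := ltgtP a 0; last 2 first.
- exact: pZ.
- by rewrite scale0r mul0r sublinear0.
have := pZ (- a) x; rewrite scaleNr podd oppr_gt0 => /(_ a0); lra.
Qed.

(** Members of [F] are compared only through a further member [k], chosen uniformly in the points.
    This covers both chains and the shifted family [g t] below, whose members need not be
    homogeneous. *)
Lemma sublinear_inf F : F !=set0 ->
  (forall x, has_lbound [set p x | p in F]) ->
  (forall p q, F p -> F q ->
    exists2 k, F k & forall x y, k (x + y) <= p x + q y) ->
  (forall p a, F p -> 0 < a ->
    exists2 k, F k & forall x, k (a *: x) <= a * p x) ->
  sublinear (fun x => inf [set p x | p in F]).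
Proof.
move=> F0 Flb FD FZ.
have Fx x : [set p x | p in F] !=set0 by case: F0 => p Fp; exists (p x), p.
have ub k x : F k -> inf [set p x | p in F] <= k x.
  by move=> Fk; apply: ge_inf; [exact: Flb|exists k].
split=> [x y|a x a0].
  rewrite -lerBlDl; apply: lb_le_inf => // _ [q Fq <-].
  rewrite lerBlDl -lerBlDr; apply: lb_le_inf => // _ [p Fp <-].
  rewrite lerBlDr; have [k Fk kpq] := FD p q Fp Fq.
  exact: le_trans (ub k _ Fk) (kpq x y).
rewrite -ler_pdivrMl//; apply: lb_le_inf => // _ [p Fp <-].
rewrite ler_pdivrMl//; have [k Fk kp] := FZ p a Fp a0.
exact: le_trans (ub k _ Fk) (kp x).
Qed.

Lemma sublinear_lower_at p y : sublinear p ->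
  exists q, [/\ sublinear q, forall x, q x <= p x & q (- y) <= - p y].
Proof.
move=> sp; have [pD pZ] := sp.
pose g (t : R) x := p (x + t *: y) - t * p y.
have pZge t : 0 <= t -> t * p y <= p (t *: y).
  rewrite le_eqVlt => /predU1P[<-|t0].
    by rewrite scale0r mul0r sublinear0.
  have := pZ t^-1 (t *: y); rewrite invr_gt0 scalerA mulVf ?gt_eqF// scale1r.
  by move=> /(_ t0); rewrite ler_pdivlMl.
pose F := [set g t | t in [set t | 0 <= t]].
(* A bound free of [t], so the infimum is genuine: [t * p y <= p (t *: y) <= p (x + t *: y) + p (-
   x)]. *)
have glb t x : 0 <= t -> - p (- x) <= g t x.
  move=> /pZge ty; rewrite /g.
  by have := pD (x + t *: y) (- x); rewrite addrAC subrr add0r; lra.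
have lbF x : has_lbound [set q x | q in F].
  by exists (- p (- x)) => _ [_ [t t0 <-] <-]; exact: glb.
exists (fun x => inf [set q x | q in F]); split.
- apply: sublinear_inf => //.
  + by exists (g 0), 0 => /=.
  + move=> _ _ [t /= t0 <-] [s /= s0 <-].
    exists (g (t + s)); first by exists (t + s) => //=; exact: addr_ge0.
    move=> x z; rewrite /g scalerDl mulrDl (addrACA x z).
    by have := pD (x + t *: y) (z + s *: y); lra.
  + move=> _ a [t /= t0 <-] a0.
    exists (g (a * t)); first by exists (a * t) => //=; rewrite mulr_ge0// ltW.
    move=> x; rewrite /g -scalerA -scalerDr.
    by have := pZ a (x + t *: y) a0; lra.
- move=> x; apply: ge_inf => //.
  exists (g 0); first by exists 0 => /=.
  by rewrite /g scale0r addr0 mul0r subr0.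
(* At [t = 1] the shift cancels [- y], leaving [p 0 - p y]. *)
- apply: ge_inf => //; exists (g 1); first by exists 1 => //=.
  by rewrite /g scale1r addNr mul1r sublinear0// add0r.
Qed.

Lemma sublinear_minimal q : sublinear q -> exists p,
  [/\ sublinear p, forall x, p x <= q x &
      forall p', sublinear p' -> (forall x, p' x <= p x) -> p' = p].
Proof.
move=> sq.
pose T := {p : V -> R | sublinear p /\ forall x, p x <= q x}.
(* The order is reversed, so that a maximal element in Zorn's lemma is a minimal functional. *)
pose le (s t : T) := `[< forall x, sval t x <= sval s x >].
have [|||A Atot|[p [sp pq]] pmin] := @Zorn T le.
- by move=> t; apply/asboolP.
- by move=> r s t /asboolP rs /asboolP st; apply/asboolP => x;
    exact: le_trans (st x) (rs x).
- move=> [r r_le] [s s_le] /asboolP /= rs /asboolP /= sr.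
  have rsE : r = s by apply/funext => x; apply/eqP; rewrite eq_le sr rs.
  by case: _ / rsE s_le rs sr => s_le _ _; congr exist; exact: Prop_irrelevance.
(* A nonempty chain is bounded by its pointwise infimum, the empty one by [q] itself. *)
- have [[a Aa]|/set0P/negP/negPn/eqP->] := pselect (A !=set0); last first.
    by exists (exist _ q (conj sq (fun=> lexx _))).
  pose F := [set sval t | t in A].
  have lbF x : has_lbound [set p x | p in F].
    exists (- q (- x)) => _ [_ [[p [sp pq]] /= _ <-] <-].
    by rewrite (le_trans _ (sublinear_ge p x sp))// lerN2.
  have sF : sublinear (fun x => inf [set p x | p in F]).
    apply: sublinear_inf => //.
    - by exists (sval a), a.
    - move=> _ _ [s As <-] [t At <-].
      have [/asboolP st|/asboolP ts] := Atot s t As At.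
      + exists (sval t); first by exists t.
        by move=> x y; rewrite (le_trans ((svalP t).1.1 x y))// lerD2r.
      + exists (sval s); first by exists s.
        by move=> x y; rewrite (le_trans ((svalP s).1.1 x y))// lerD2l.
    - move=> _ b [s As <-] b0; exists (sval s); first by exists s.
      by move=> x; exact: (svalP s).1.2.
  have Fle s x : A s -> inf [set p x | p in F] <= sval s x.
    by move=> As; apply: ge_inf => //; exists (sval s) => //; exists s.
  have Fq x : inf [set p x | p in F] <= q x.
    exact: le_trans (Fle a x Aa) ((svalP a).2 x).
  exists (exist _ (fun x => inf [set p x | p in F]) (conj sF Fq)) => s As.
  by apply/asboolP => x; exact: Fle.
- exists p; split => // p' sp' p'p.
  have p'q x : p' x <= q x := le_trans (p'p x) (pq x).
  have /(_ _)/(congr1 sval) := pmin (exist _ p' (conj sp' p'q)).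
  by apply; apply/asboolP.
Qed.

Lemma hahn_banach_at q y : sublinear q -> exists p,
  [/\ linear (p : V -> R^o), forall x, p x <= q x & p y = q y].
Proof.
move=> sq; have [k [sk kq ky]] := sublinear_lower_at q y sq.
have [p [sp pk pmin]] := sublinear_minimal k sk.
(* By minimality, the functional lowered at [x] is [p] again. *)
have pN x : p (- x) <= - p x.
  by have [p' [sp' /(pmin _ sp') ->]] := sublinear_lower_at p x sp.
exists p; split; first exact: sublinear_odd_linear.
  by move=> x; exact: le_trans (pk x) (kq x).
(* The lower bound is [p y >= - p (- y) >= - k (- y) >= q y]. *)
apply/eqP; rewrite eq_le (le_trans (pk y) (kq y)) /=.
by have := sublinear_ge p y sp; have := pk (- y); lra.
Qed.

End sublinear_functionals.

(** * Norming functionals, the duality mapping and oscillation bounds *)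

Section normed_spaces.
Context {R : realType}.

Lemma norm_sublinear (V : normedModType R) : sublinear (fun x : V => `|x|).
Proof.
by split=> [x y|a x a0]; [exact: ler_normD|rewrite normrZ gtr0_norm].
Qed.

(** Applying the one-sided bound at [- v] gives the two-sided one. *)
Lemma dual_norm_le_sublinear (V : normedModType R) (g : dual V) (K : R) :
  0 <= K -> (forall v, g v <= K * `|v|) -> `|g| <= K.
Proof.
move=> K0 gK; apply: dual_norm_le => v v1.
apply: (@le_trans _ _ (K * `|v|)); last exact: ler_piMr.
by rewrite ler_norml gK andbT lerNl -linearN -(normrN v) gK.
Qed.

Lemma norming_functional (V : normedModType R) (y : V) :
  exists2 g : dual V, g y = `|y| & `|g| <= 1.
Proof.
have [p [lp p_le py]] := hahn_banach_at _ y (norm_sublinear V).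
pose ip := GRing.isLinear.Build R V R^o *:%R p lp.
pose lf : {linear V -> R^o} := HB.pack (p : V -> R^o) ip.
have cp : continuous (p : V -> R^o).
  apply: (bounded_linear_continuous (f := lf)); apply/linear_boundedP.
  near=> r => x; apply: (@le_trans _ _ `|x|).
    rewrite ler_norml p_le andbT lerNl -(linearN lf x) /= -(normrN x).
    exact: p_le.
  by apply: ler_peMl => //; near: r; apply: nbhs_pinfty_ge; exact: num_real.
have pd : (p : V -> R^o) \in dual_pred V by rewrite inE.
exists (Dual pd) => //; apply: dual_norm_le_sublinear => // v.
by rewrite mul1r; exact: p_le.
Unshelve. all: by end_near. Qed.

(** A norming functional [g] scaled by [|y|] belongs to [duality_map y], so [xget] never returns its
    default. *)
Lemma duality_funP (V : normedModType R) (y : V) :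
  duality_map y (duality_fun y).
Proof.
have [g gy g1] := norming_functional V y.
apply: (@xgetPex _ 0 (duality_map y)); exists (`|y| *: g).
have gyE : (`|y| *: g) y = `|y| ^+ 2 by rewrite [LHS]/(`|y| * g y) gy.
split=> //; congr (_ ^+ 2); apply/eqP; rewrite eq_le normrZ normr_id.
rewrite ler_piMr// andbT.
have [->|y0] := eqVneq y 0; first by rewrite normr0 mul0r.
rewrite ler_peMr//.
(* From [|y| = g y <= |g| * |y|] with [y] nonzero, [1 <= |g|]. *)
have := ler_dual_pairing g y; rewrite gy normr_id -[leLHS]mul1r.
by rewrite ler_pM2r ?normr_gt0.
Qed.

Lemma duality_fun_self (V : normedModType R) (y : V) :
  duality_fun y y = `|y| ^+ 2.
Proof. by case: (duality_funP V y). Qed.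

Lemma duality_fun_norm (V : normedModType R) (y : V) :
  `|duality_fun y| = `|y|.
Proof.
have [_ /esym/eqP] := duality_funP V y.
by rewrite eqrXn2// => /eqP.
Qed.

Lemma dual_pairing_le (V : normedModType R) (g : dual V) (v : V) :
  g v <= `|g| * `|v|.
Proof. exact: le_trans (ler_norm _) (ler_dual_pairing g v). Qed.

Lemma le_best_error (X : normedModType R) (x : X) (S : set X) (a c : R) :
  0 < c -> S !=set0 -> (forall w, S w -> a <= c * `|x - w|) ->
  a <= c * best_error x S.
Proof.
move=> c0 [w0 Sw0] aS; rewrite -ler_pdivrMl//; apply: lb_le_inf.
  by exists `|x - w0|, w0.
by move=> _ [w Sw <-]; rewrite ler_pdivrMl// aS.
Qed.

Lemma osc_ge (V : normedModType R) (Pi : V -> V) (D : R) (f : dual V) (v : V) :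
  (forall v, `|v - Pi v| <= D * `|v|) -> f (v - Pi v) <= osc Pi f * `|v|.
Proof.
move=> PiD; have [->|v0] := eqVneq v 0.
  (* [Pi] is a bare function: its value at [0] comes from the bound there. *)
  have /eqP -> : 0 - Pi 0 == 0.
    by rewrite -normr_le0 (le_trans (PiD 0))// normr0 mulr0.
  by rewrite linear0 normr0 mulr0.
rewrite -ler_pdivrMr ?normr_gt0//; apply: ub_le_sup; last by exists v.
exists (`|f| * D) => _ [w /= w0 <-].
rewrite ler_pdivrMr ?normr_gt0// -mulrA.
by rewrite (le_trans (dual_pairing_le V f _))// ler_wpM2l.
Qed.

(** The sign of [K] settles the zero space, where the supremum is [0]. *)
Lemma osc_le (V : normedModType R) (Pi : V -> V) (f : dual V) (K : R) :
  0 <= K -> (forall v, f (v - Pi v) <= K * `|v|) -> osc Pi f <= K.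
Proof.
move=> K0 fK; rewrite /osc; set S := [set _ | _ in _].
have [S0|/set0P/negP/negPn/eqP ->] := pselect (S !=set0); last by rewrite sup0.
by apply: ge_sup => // _ [v /= v0 <-]; rewrite ler_pdivrMr ?normr_gt0.
Qed.

End normed_spaces.

Theorem theorem4 (R : realType) (U V : completeNormedModType R)
  (B : {linear U -> dual V}) (M_B gamma_B : R)
  (M_B_gt0 : 0 < M_B) (gamma_B_gt0 : 0 < gamma_B)
  (B_bounds : forall w : U,
    gamma_B * `|w| <= `|B w| /\ `|B w| <= M_B * `|w|)
  (V_reflexive : reflexive_space V) (dualV_reflexive : reflexive_space (dual V))
  (V_convex : strictly_convex_space V)
  (dualV_convex : strictly_convex_space (dual V))
  (U_n : set U) (V_m : set V)
  (U_n_findim : findim_subspace U_n) (V_m_findim : findim_subspace V_m)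
  (Pi : V -> V) (C_Pi D_Pi : R) (C_Pi_gt0 : 0 < C_Pi) (D_Pi_gt0 : 0 < D_Pi)
  (Pi_V_m : forall v : V, V_m (Pi v))
  (Pi_bound : forall v : V, `|Pi v| <= C_Pi * `|v|)
  (Pi_compl_bound : forall v : V, `|v - Pi v| <= D_Pi * `|v|)
  (Pi_orth : forall (w_n : U) (v : V), U_n w_n -> B w_n (v - Pi v) = 0)
  (u : U) (f : dual V) (f_def : f = B u)
  (r_m : V) (u_n : U) (r_m_V_m : V_m r_m) (u_n_U_n : U_n u_n)
  (residual_eq : forall v_m : V, V_m v_m ->
    duality_fun r_m v_m + B u_n v_m = f v_m)
  (constraint_eq : forall w_n : U, U_n w_n -> B w_n r_m = 0) :
  [/\ `|u - u_n| <= gamma_B^-1 * osc Pi f + C_Pi / gamma_B * `|r_m|,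
      osc Pi f <= M_B * D_Pi * best_error u U_n &
      `|r_m| <= M_B * best_error u U_n].
Proof.
have B_sub x y v : B (x - y) v = B x v - B y v by rewrite linearB.
pose K0 := osc Pi f + C_Pi * `|r_m|.
have errV v : B (u - u_n) v <= K0 * `|v|.
  have -> : B (u - u_n) v = f (v - Pi v) + duality_fun r_m (Pi v).
    have := residual_eq _ (Pi_V_m v); have := Pi_orth u_n v u_n_U_n.
    by rewrite B_sub -f_def !linearB /=; lra.
  rewrite /K0 mulrDl; apply: lerD; first exact: osc_ge Pi_compl_bound.
  rewrite (le_trans (dual_pairing_le V _ _))// duality_fun_norm.
  by rewrite (mulrC C_Pi) -mulrA ler_wpM2l.
(* Serves twice: with [v - Pi v] for the oscillation and with [r_m] for the residual. *)
have errW w v : B w v = 0 -> B u v <= M_B * `|u - w| * `|v|.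
  move=> Bwv; have -> : B u v = B (u - w) v.
    by rewrite B_sub Bwv subr0.
  rewrite (le_trans (dual_pairing_le V _ _))// ler_wpM2r//.
  by case: (B_bounds (u - w)).
have MD0 : 0 < M_B * D_Pi by exact: mulr_gt0.
have U0 : U_n !=set0 by exists u_n.
split.
(* Adding [errV] at [v] and [- v] gives [0 <= 2 * K0 * |v|]; in the zero space [osc Pi f] is
   [sup set0 = 0]. *)
- have K_ge0 : 0 <= K0.
    have [[v v0]|/forallNP V0] := pselect (exists v : V, v != 0).
      have := errV v; have := errV (- v); rewrite linearN normrN.
      have : 0 < `|v| by rewrite normr_gt0.
      by nra.
    rewrite /K0 addr_ge0//; last by rewrite mulr_ge0// ltW.
    rewrite /osc.
    suff -> : [set v : V | v != 0] = set0 by rewrite image_set0 sup0.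
    by rewrite -subset0 => v /V0.
  have -> : gamma_B^-1 * osc Pi f + C_Pi / gamma_B * `|r_m| = gamma_B^-1 * K0.
    by rewrite /K0 mulrDr mulrA (mulrC C_Pi).
  rewrite ler_pdivlMl// (le_trans (B_bounds _).1)//.
  exact: dual_norm_le_sublinear.
- apply: le_best_error => // w Uw; apply: osc_le => [|v].
    by rewrite mulr_ge0// ltW.
  rewrite f_def (le_trans (errW w _ (Pi_orth w v Uw)))//.
  by rewrite (mulrAC M_B D_Pi) -[leRHS]mulrA ler_wpM2l// mulr_ge0// ltW.
- apply: le_best_error => // w Uw.
  (* The case is split off because a factor [|r_m|] is cancelled from
     [|r_m|^2 <= M_B * |u - w| * |r_m|]. *)
  have [->|r0] := eqVneq r_m 0; first by rewrite normr0 mulr_ge0// ltW.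
  have := errW w r_m (constraint_eq w Uw).
  have := residual_eq r_m r_m_V_m.
  rewrite duality_fun_self constraint_eq// addr0 f_def => <-.
  by rewrite expr2 ler_pM2r ?normr_gt0.
Qed.
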